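(* Every $n\times n$ oscillatory matrix $A$ satisfies $$|e_{k+1}(A)-e_k(A)|\le1,\qquad 1\le k\le n-2.$$
   Context: All matrices are real and have order $n\ge2$. A matrix is totally nonnegative (TN) if all its minors are $\ge0$ and totally positive (TP) if all its minors are $>0$; a square TN matrix is oscillatory if some positive power of it is TP. For an oscillatory matrix $A$ and $1\le k\le n$, $e_k(A)=\min\{m\ge1:\text{all minors of order }k\text{ of }A^m\text{ are positive}\}$. *)

(* Defs.v *)
From HB Require Import structures.
From mathcomp Require Import all_boot all_order all_algebra.
From mathcomp Require Import reals.

Set Implicit Arguments.
Unset Strict Implicit.
Unset Printing Implicit Defensive.

Import Order.TTheory GRing.Theory Num.Theory.
Local Open Scope ring_scope.

Definition increasing (k n : nat) (f : {ffun 'I_k -> 'I_n}) : bool :=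
  [forall i : 'I_k, forall j : 'I_k, (i < j)%N ==> (f i < f j)%N].

(* The minor on rows f 0 < ... < f (k-1) and columns g 0 < ... < g (k-1);
   it is a minor in the usual sense only for increasing f and g. *)
Definition minor (R : realType) (n k : nat) (A : 'M[R]_n)
    (f g : {ffun 'I_k -> 'I_n}) : R :=
  \det (mxsub f g A).

Definition minors_ge0 (R : realType) (n k : nat) (A : 'M[R]_n) : bool :=
  [forall f : {ffun 'I_k -> 'I_n}, forall g : {ffun 'I_k -> 'I_n},
     increasing f ==> increasing g ==> (0 <= minor A f g)].

Definition minors_gt0 (R : realType) (n k : nat) (A : 'M[R]_n) : bool :=
  [forall f : {ffun 'I_k -> 'I_n}, forall g : {ffun 'I_k -> 'I_n},
     increasing f ==> increasing g ==> (0 < minor A f g)].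

(* Only the orders 1 <= k <= n matter in the next two definitions: the minor
   of order 0 is 1, and there is no minor of order k > n. *)
Definition totally_nonnegative (R : realType) (n : nat) (A : 'M[R]_n) : Prop :=
  forall k : nat, minors_ge0 k A.

Definition totally_positive (R : realType) (n : nat) (A : 'M[R]_n) : Prop :=
  forall k : nat, minors_gt0 k A.

Definition oscillatory (R : realType) (n : nat) (A : 'M[R]_n) : Prop :=
  totally_nonnegative A /\
  exists m : nat, (0 < m)%N /\ totally_positive (A ^+ m).

Lemma exponent_exists (R : realType) (n : nat) (A : 'M[R]_n) (k : nat) :
  oscillatory A -> exists m : nat, (0 < m)%N && minors_gt0 k (A ^+ m).
Proof. by case=> _ [m [m_gt0 TPm]]; exists m; rewrite m_gt0 TPm. Qed.

(* e_k(A); by minimality the value does not depend on the proof oscA. *)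
Definition exponent (R : realType) (n : nat) (A : 'M[R]_n)
    (oscA : oscillatory A) (k : nat) : nat :=
  ex_minn (exponent_exists k oscA).

(* Main.v *)
Require Import Defs.
From mathcomp Require Import all_boot all_order all_algebra.
From mathcomp Require Import reals zify ring.

Set Implicit Arguments.
Unset Strict Implicit.
Unset Printing Implicit Defensive.

Import Order.TTheory GRing.Theory Num.Theory.
Local Open Scope ring_scope.

(** The theorem is about a game of particles on a line. By Whitney's theorem
    ([TN_factorization]) a nonsingular totally nonnegative matrix is a product
    of positive diagonal matrices and of factors [1 + t E_ab] with [t > 0] and
    [|a - b| = 1]. Multiplying on the left by such a factor adds to a minor
    with row [a], and without row [b], [t] times the minor in which [b]
    replaces [a]. All terms being nonnegative, the minor on rows [f] and
    columns [g] is positive exactly when particles placed at [f] can be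
    brought to [g] by reading the factors as moves: the factor [(a, b)] may
    carry a particle from [a] to [b], if [b] is free ([minor_gt0_reach]). The
    [m]-th power corresponds to [m] rounds of the same word of moves, so [e_k]
    is the number of rounds after which [k] particles can have gone from
    anywhere to anywhere.

    Reachability is preserved by componentwise maxima and minima of positions,
    so that only the two extreme journeys matter, from the lowest to the
    highest configuration and back ([corner_reach]). The journey back is the
    journey up for the transposed matrix. For the journey up, the best
    strategy is greedy: move every particle upwards whenever possible. In
    terms of heights, [h q] being the number of particles below [q], a move
    from [p - 1] to [p] then replaces [h p] by the maximum of [h (p - 1)] and
    [h (p + 1) - 1] ([reach_corner]).

    It remains to compare greedy journeys of [k] and [k + 1] particles. With
    one more particle, the new one starts on top, where nothing obstructs it;
    since one round offers a move at each site, after one round it is far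
    enough ahead never to block the others, which therefore lag at most one
    round behind the system of [k] particles until they pile up below it
    ([rounds_lag]). Exchanging particles with holes and reversing the line
    preserves the greedy rule and turns [k] and [k + 1] particles into [n - k]
    and [n - k - 1] particles; this gives the other inequality
    ([rounds_lag_dual]). *)

(** * Minors and increasing index maps *)

Definition setrow (R : Type) (m n : nat) (N : 'M[R]_(m, n)) (s : 'I_m)
    (z : 'rV[R]_n) : 'M[R]_(m, n) :=
  \matrix_(i, j) if i == s then z 0 j else N i j.

Lemma row'_setrow (R : Type) (m n : nat) (N : 'M[R]_(m, n)) s z :
  row' s (setrow N s z) = row' s N.
Proof. by apply/matrixP=> i j; rewrite !mxE eq_sym (negbTE (neq_lift _ _)). Qed.

Lemma cofactor_setrow (R : pzRingType) (n : nat) (N : 'M[R]_n) s z j :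
  cofactor (setrow N s z) s j = cofactor N s j.
Proof.
have row'C (B : 'M[R]_n) : row' s (col' j B) = col' j (row' s B).
  by apply/matrixP=> i l; rewrite !mxE.
by rewrite /cofactor !row'C row'_setrow.
Qed.

Lemma det_setrow (R : comPzRingType) (n : nat) (N : 'M[R]_n) s z :
  \det (setrow N s z) = (z *m \adj N) 0 s.
Proof.
rewrite (expand_det_row _ s) !mxE; apply: eq_bigr => j _.
by rewrite cofactor_setrow !mxE eqxx.
Qed.

(** A three-term Plücker relation: the determinants involved are those of
    the rows other than [i] and [s], completed by two of row [i], row [s], [z]
    and the [j]-th unit vector. *)
Lemma setrow_plucker (R : comPzRingType) (n : nat) (N : 'M[R]_n) (s i j : 'I_n)
    (z : 'rV[R]_n) : i != s ->
  \det N * cofactor (setrow N s z) i j + cofactor N s j * \det (setrow N i z)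
  = \det (setrow N s z) * cofactor N i j.
Proof.
move=> ne_is; set P := setrow N s z; rewrite det_setrow.
(* Apart from row s, P *m \adj N agrees with the scalar matrix N *m \adj N;
   so only the terms of rows i and s survive in \adj P *m P *m \adj N. *)
have := congr1 (fun M => (M *m \adj N) j i) (mul_adj_mx P).
rewrite mul_scalar_mx [RHS]mxE [\adj N _ _]mxE => <-.
rewrite -mulmxA [RHS]mxE (bigD1 i) //= (bigD1 s) 1?eq_sym //= big1 ?addr0.
  rewrite ![\adj P _ _]mxE /P cofactor_setrow mulrC; congr (_ * _ + _ * _).
    transitivity ((N *m \adj N) i i); first by rewrite mul_mx_adj mxE eqxx.
    by rewrite !mxE; apply: eq_bigr => l _; rewrite !mxE (negbTE ne_is).
  by rewrite !mxE; apply: eq_bigr => l _; rewrite !mxE eqxx.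
move=> r /andP[ne_ri ne_rs].
have -> : (P *m \adj N) r i = (N *m \adj N) r i.
  by rewrite !mxE; apply: eq_bigr => l _; rewrite !mxE (negbTE ne_rs).
by rewrite mul_mx_adj [_%:M _ _]mxE (negbTE ne_ri) mulr0n mulr0.
Qed.

Definition inc (k n : nat) (f : 'I_k -> 'I_n) : Prop :=
  {homo f : i j / (i < j)%N}.

Lemma inc_injective k n (f : 'I_k -> 'I_n) : inc f -> injective f.
Proof.
move=> incf i j eq_fij; apply: val_inj => /=.
by case: (ltngtP i j) => // /incf; rewrite eq_fij ltnn.
Qed.

Lemma inc_comp k m n (f : 'I_m -> 'I_n) (g : 'I_k -> 'I_m) :
  inc f -> inc g -> inc (f \o g).
Proof. by move=> incf incg i j lt_ij; apply/incf/incg. Qed.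

Lemma inc_lift n (h : 'I_n) : inc (lift h).
Proof. by move=> i j /=; rewrite /bump; lia. Qed.

(** For increasing [f], the index map enumerating the positions [f] together
    with [x], when [x] belongs at rank [s]. *)
Definition insert_at (k n : nat) (s : 'I_k.+1) (x : 'I_n) (f : 'I_k -> 'I_n)
    (j : 'I_k.+1) : 'I_n := oapp f x (unlift s j).

Lemma insert_at_at k n s (x : 'I_n) (f : 'I_k -> 'I_n) : insert_at s x f s = x.
Proof. by rewrite /insert_at unlift_none. Qed.

Lemma insert_at_lift k n s (x : 'I_n) (f : 'I_k -> 'I_n) j :
  insert_at s x f (lift s j) = f j.
Proof. by rewrite /insert_at liftK. Qed.

Lemma inc_insert_at k n (s : 'I_k.+1) (x : 'I_n) (f : 'I_k -> 'I_n) : inc f ->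
  (forall j : 'I_k, (j < s)%N -> (f j < x)%N) ->
  (forall j : 'I_k, (s <= j)%N -> (x < f j)%N) -> inc (insert_at s x f).
Proof.
move=> incf ltfx ltxf i j; rewrite /insert_at.
case: unliftP => [i'|] ->; case: unliftP => [j'|] -> /=; rewrite /bump => lt_ij.
- by apply: incf; lia.
- by apply: ltfx; lia.
- by apply: ltxf; lia.
- by lia.
Qed.

Definition replace_at (k n : nat) (f : 'I_k -> 'I_n) (s : 'I_k) (b : 'I_n)
    (j : 'I_k) : 'I_n := if j == s then b else f j.

Lemma mxsub_replace_at (R : Type) m n k l (A : 'M[R]_(m, n)) (f : 'I_k -> 'I_m)
    (g : 'I_l -> 'I_n) s b :
  mxsub (replace_at f s b) g A = setrow (mxsub f g A) s (row b (colsub g A)).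
Proof. by apply/matrixP=> i j; rewrite !mxE /replace_at; case: eqP. Qed.

Section TotalNonnegativity.
Variable R : realFieldType.

(** Total nonnegativity for rectangular matrices, which makes it stable under
    taking submatrices. *)
Definition TN (m n : nat) (A : 'M[R]_(m, n)) : Prop :=
  forall k (f : 'I_k -> 'I_m) (g : 'I_k -> 'I_n),
    inc f -> inc g -> 0 <= \det (mxsub f g A).

Lemma TN_mxsub m n k l (A : 'M[R]_(m, n)) (f : 'I_k -> 'I_m)
    (g : 'I_l -> 'I_n) : TN A -> inc f -> inc g -> TN (mxsub f g A).
Proof.
move=> tnA incf incg r f' g' incf' incg'; rewrite -mxsub_comp.
by apply: tnA; apply: inc_comp.
Qed.

Lemma TN_ge0 m n (A : 'M[R]_(m, n)) i j : TN A -> 0 <= A i j.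
Proof.
move=> /(_ 1%N (fun=> i) (fun=> j)); rewrite det_mx11 mxE; apply.
  by move=> x y; rewrite !ord1.
by move=> x y; rewrite !ord1.
Qed.

Lemma TN_tr m n (A : 'M[R]_(m, n)) : TN A -> TN A^T.
Proof.
by move=> tnA k f g incf incg; rewrite -trmx_mxsub det_tr; apply: tnA.
Qed.

Lemma row'_col'_mxsub n (N : 'M[R]_n) i j :
  row' i (col' j N) = mxsub (lift i) (lift j) N.
Proof. by apply/matrixP=> x y; rewrite !mxE. Qed.

Lemma TN_cofactor n (N : 'M[R]_n) i j : TN N ->
  exists2 m, 0 <= m & cofactor N i j = (-1) ^+ (i + j) * m.
Proof.
move=> tnN; exists (\det (row' i (col' j N))) => //.
by rewrite row'_col'_mxsub; apply: tnN; apply: inc_lift.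
Qed.

(** If the corner cofactor vanished, the Plücker relation with [z] a unit
    vector, that is the Desnanot-Jacobi identity, would have a sum of two
    nonnegative terms equal to zero. Hence each product of a cofactor of
    column [0] and a cofactor of row [0] would vanish, all cofactors of that
    column or of that row would be zero, and the determinant as well. *)
Lemma cofactor00_gt0 n (N : 'M[R]_n.+1) : TN N -> 0 < \det N ->
  0 < cofactor N 0 0.
Proof.
move=> tnN d_gt0; have [m00 m00_ge0 c00] := TN_cofactor 0 0 tnN.
rewrite lt_def {2}c00 mul1r m00_ge0 andbT; apply/eqP=> c00_0.
have key (s l : 'I_n) :
    cofactor N (lift 0 s) 0 = 0 \/ cofactor N 0 (lift 0 l) = 0.
  have [m1 m1_ge0 cs0] := TN_cofactor (lift 0 s) 0 tnN.
  have [m2 m2_ge0 c0l] := TN_cofactor 0 (lift 0 l) tnN.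
  have tnN' : TN (row' 0 (col' 0 N)).
    by rewrite row'_col'_mxsub; apply: TN_mxsub => //; apply: inc_lift.
  have [m3 m3_ge0 csl] := TN_cofactor s l tnN'.
  have := @setrow_plucker _ _ N (lift 0 s) 0 0 (delta_mx 0 (lift 0 l)) (neq_lift _ _).
  rewrite c00_0 mulr0 det_setrow -rowE [row _ _ _ _]mxE [\adj _ _ _]mxE.
  have -> : cofactor (setrow N (lift 0 s) (delta_mx 0 (lift 0 l))) 0 0
          = cofactor (row' 0 (col' 0 N)) s l.
    rewrite {1}/cofactor mul1r.
    have -> : row' 0 (col' 0 (setrow N (lift 0 s) (delta_mx 0 (lift 0 l))))
            = setrow (row' 0 (col' 0 N)) s (delta_mx 0 l).
      apply/matrixP=> x y; rewrite !mxE !eqxx /=.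
      by rewrite !(inj_eq lift_inj).
    by rewrite det_setrow -rowE !mxE.
  rewrite csl cs0 c0l !lift0 addn0 add0n.
  rewrite (_ : _ + _ = (-1) ^+ (s + l) * (\det N * m3 + m1 * m2)); last first.
    by rewrite exprD !exprS; ring.
  move/eqP; rewrite mulrI_eq0; last by apply: mulrI; rewrite unitrX // unitrN1.
  have ge0_1 : 0 <= \det N * m3 by rewrite mulr_ge0 // ltW.
  have ge0_2 : 0 <= m1 * m2 by rewrite mulr_ge0.
  rewrite paddr_eq0 // => /andP[_]; rewrite mulf_eq0 => /orP[]/eqP->.
    by left; rewrite mulr0.
  by right; rewrite mulr0.
have : \det N = 0; last by move=> d0; rewrite d0 ltxx in d_gt0.
have [all0|] := boolP [forall l : 'I_n, cofactor N 0 (lift 0 l) == 0].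
  rewrite (expand_det_row _ 0) big1 // => l _.
  by case: (unliftP 0 l) => [l'|] ->; rewrite ?c00_0 ?(eqP (forallP all0 l')) mulr0.
rewrite negb_forall => /existsP[l /eqP nz].
rewrite (expand_det_col _ 0) big1 // => s _.
case: (unliftP 0 s) => [s'|] ->; rewrite ?c00_0 ?mulr0 //.
by case: (key s' l) => // ->; rewrite mulr0.
Qed.

(** * Whitney's factorization *)

Lemma inc_min k n (f : 'I_k.+1 -> 'I_n) j : inc f -> (f 0%R <= f j)%N.
Proof. by case: (unliftP 0 j) => [j'|] -> // incf; apply/ltnW/incf. Qed.

(** The inequality behind Whitney's elimination: replacing row [i] by the next
    row multiplies a minor at least by the ratio [A i1 c / A i c] found in
    column [c]. By induction on the number of rows above row [i]. With no such
    row, the difference of both sides is the expansion along column [c] of the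
    minor on rows [i], [i1] and the other ones. Otherwise the Plücker relation
    shows that deleting the first row and the first column cannot increase the
    factor by which the minor is multiplied. *)
Lemma whitney_ratio m n (A : 'M[R]_(m, n)) (i i1 : 'I_m) (c : 'I_n) :
  TN A -> i1 = i.+1 :> nat ->
  (forall r : 'I_m, (i1 < r)%N -> A r c = 0) ->
  (forall (r : 'I_m) (l : 'I_n), (i <= r)%N -> (l < c)%N -> A r l = 0) ->
  forall k (f : 'I_k -> 'I_m) (g : 'I_k -> 'I_n) (s : 'I_k),
    inc f -> inc g -> f s = i -> (forall j, f j <> i1) ->
  \det (mxsub f g A) * A i1 c <= A i c * \det (mxsub (replace_at f s i1) g A).
Proof.
move=> tnA def_i1 zc zl; elim=> [|k IHk] f g s incf incg fs nf; first by case: (s).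
have incf' : inc (replace_at f s i1).
  move=> x y lt_xy; have lt_f := incf _ _ lt_xy; rewrite /replace_at.
  case: eqP lt_f => [-> | _]; case: eqP => [-> | _] //; rewrite fs => lt_f.
  - by rewrite ltnn in lt_f.
  - have ne : f y <> i1 :> nat by move/val_inj; apply: nf.
    by lia.
  - by lia.
have D_ge0 := tnA _ _ _ incf' incg.
have := tnA _ _ _ incf incg; rewrite le_eqVlt => /predU1P[<-|d_gt0].
  by rewrite mul0r mulr_ge0 // TN_ge0.
move: fs incf' D_ge0; case: (unliftP 0 s) => [s'|] -> fs incf' D_ge0; last first.
  have le_cg : (c <= g 0%R)%N.
    rewrite leqNgt; apply/negP => lt_gc; move: d_gt0.
    rewrite (expand_det_col _ 0) big1 ?ltxx // => r _; rewrite mxE zl ?mul0r //.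
    by rewrite -fs inc_min.
  (* When g 0 = c the column c occurs twice in M, and \det M = 0. *)
  pose M := mxsub (insert_at 0 i (replace_at f 0 i1)) (insert_at 0 c g) A.
  have incF : inc (insert_at 0 i (replace_at f 0 i1)).
    apply: inc_insert_at => // j _; rewrite /replace_at.
    case: (unliftP 0 j) => [j'|] ->; last by rewrite eqxx def_i1.
    by rewrite (_ : _ == _ = false) //; have := incf 0 (lift 0 j') isT; rewrite fs.
  have M_ge0 : 0 <= \det M.
    case: (ltngtP c (g 0%R)) le_cg => // [lt_cg _|/val_inj eq_cg _].
      apply: tnA => //; apply: inc_insert_at => // j _; apply: (leq_trans lt_cg).
      exact: inc_min.
    have -> : \det M = 0; last by [].
    rewrite -det_tr (@determinant_alternate _ _ _ 0 (lift 0 0)) // => r.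
    by rewrite !mxE insert_at_at insert_at_lift eq_cg.
  rewrite -subr_ge0; suff <- : \det M = A i c * \det (mxsub (replace_at f 0 i1) g A)
    - \det (mxsub f g A) * A i1 c by [].
  rewrite (expand_det_col _ 0) big_ord_recl big_ord_recl big1 ?addr0.
    congr (_ + _).
      rewrite mxE !insert_at_at /cofactor mul1r row'_col'_mxsub -mxsub_comp.
      congr (_ * \det _); apply: eq_mxsub => x /=; exact: insert_at_lift.
    rewrite mxE insert_at_lift insert_at_at /replace_at eqxx /cofactor lift0 expr1.
    rewrite row'_col'_mxsub -mxsub_comp mulN1r mulrN mulrC; congr (- (\det _ * _)).
    apply: eq_mxsub => x /=; last exact: insert_at_lift.
    case: (unliftP 0 x) => [y|] ->.
      have -> : lift (lift 0 0) (lift 0 y) = lift 0 (lift 0 y) :> 'I_k.+2.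
        by apply: val_inj; rewrite /= /bump; lia.
      by rewrite insert_at_lift.
    have -> : lift (lift 0 0) 0 = 0 :> 'I_k.+2 by apply: val_inj.
    by rewrite insert_at_at fs.
  move=> j _; rewrite mxE insert_at_lift insert_at_at /replace_at (_ : _ == _ = false) //.
  rewrite zc ?mul0r //.
  have := incf' 0 (lift 0 j) isT; rewrite /replace_at eqxx.
  by rewrite (_ : _ == _ = false).
set N := mxsub f g A in d_gt0 *.
set z := row i1 (colsub g A); rewrite mxsub_replace_at -/N -/z in D_ge0 *.
have tnN : TN N by apply: TN_mxsub.
have c_gt0 := cofactor00_gt0 tnN d_gt0.
have IH := IHk (f \o lift 0) (g \o lift 0) s' (inc_comp incf (@inc_lift _ _))
  (inc_comp incg (@inc_lift _ _)) fs (fun j => nf _).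
have E1 : cofactor N 0 0 = \det (mxsub (f \o lift 0) (g \o lift 0) A).
  by rewrite /cofactor mul1r row'_col'_mxsub mxsub_comp.
have E2 : cofactor (setrow N (lift 0 s') z) 0 0 =
    \det (mxsub (replace_at (f \o lift 0) s' i1) (g \o lift 0) A).
  rewrite /cofactor mul1r row'_col'_mxsub -mxsub_replace_at -mxsub_comp.
  congr (\det _); apply: eq_mxsub => x //=.
have := setrow_plucker N 0 z (neq_lift 0 s').
rewrite -E1 -E2 in IH.
set D := \det (setrow N (lift 0 s') z).
set phi := cofactor (setrow _ _ _) 0 0; set psi := \det (setrow N 0 z).
have : 0 <= cofactor N (lift 0 s') 0 * psi.
  have [m1 m1_ge0 ->] := TN_cofactor (lift 0 s') 0 tnN.
  (* psi is, up to the sign of the cofactor, the minor with its rows listed in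
     increasing order: the first one dropped, row i1 inserted after row i. *)
  pose F := insert_at (lift 0 s') i1 (f \o lift 0).
  have incF : inc F.
    apply: inc_insert_at; first exact: inc_comp incf (@inc_lift _ _).
      move=> j; rewrite lift0 ltnS leq_eqVlt => /predU1P[/val_inj->|lt_j] /=.
        by rewrite fs def_i1.
      have : (lift 0%R j < lift 0%R s')%N by rewrite /= /bump; lia.
      by move/incf; rewrite fs; lia.
    move=> j; rewrite lift0 => lt_j.
    have := incf' (lift 0 s') (lift 0 j); rewrite /replace_at eqxx (inj_eq lift_inj).
    case: eqP => [eqj|_ /=]; first by move: lt_j; rewrite eqj ltnn.
    by apply; rewrite /bump; lia.
  have -> : psi = (-1) ^+ (lift 0 s') * \det (mxsub F g A).
    rewrite /psi (expand_det_row _ 0) (expand_det_row _ (lift 0 s')) mulr_sumr.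
    apply: eq_bigr => j _.
    have -> : cofactor (mxsub F g A) (lift 0 s') j
        = (-1) ^+ (lift 0 s') * cofactor N 0 j.
      rewrite /cofactor add0n (exprD _ (lift 0 s') j) -mulrA.
      rewrite !row'_col'_mxsub -!mxsub_comp; congr (_ * (_ * \det _)).
      by apply: eq_mxsub => x //=; rewrite /F insert_at_lift.
    by rewrite cofactor_setrow !mxE /F insert_at_at eqxx [RHS]mulrCA signrMK.
  rewrite addn0 mulrACA -expr2 sqrr_sign mul1r mulr_ge0 //.
  exact: tnA.
have x_ge0 : 0 <= A i c by exact: TN_ge0.
have y_ge0 : 0 <= A i1 c by exact: TN_ge0.
move: IH D_ge0 c_gt0 d_gt0 x_ge0; rewrite -/phi -/D.
move: (cofactor N 0 0) (cofactor N _ 0 * psi) (\det N) (A i c) (A i1 c) D phi.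
move=> c0 e d x y D phi IH D_ge0 c_gt0 d_gt0 x_ge0 e_ge0 eqD.
rewrite -(ler_pM2r c_gt0) -[x * D * c0]mulrA -eqD mulrDr.
rewrite (_ : d * y * c0 = d * (c0 * y)); last by ring.
apply: (le_trans (y := d * (x * phi))); first by rewrite ler_pM2l.
by rewrite (_ : x * (d * phi) = d * (x * phi)) ?lerDl ?mulr_ge0 //; ring.
Qed.

Definition elem (n : nat) (a b : 'I_n) (t : R) : 'M[R]_n :=
  1%:M + t *: delta_mx a b.

Lemma mul_elem n p (a b : 'I_n) t (B : 'M[R]_(n, p)) :
  elem a b t *m B = setrow B a (row a B + t *: row b B).
Proof.
apply/matrixP=> i j; rewrite mulmxDl mul1mx -scalemxAl !mxE (bigD1 b) //= big1.
  rewrite !mxE eqxx andbT addr0; case: eqP => [->|_] //=; first by rewrite mul1r.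
  by rewrite mul0r mulr0 addr0.
by move=> l /negbTE ne_lb; rewrite !mxE ne_lb andbF mul0r.
Qed.

Lemma minor_elem_notin n p k (a b : 'I_n) t (B : 'M[R]_(n, p))
    (f : 'I_k -> 'I_n) (g : 'I_k -> 'I_p) : (forall j, f j != a) ->
  mxsub f g (elem a b t *m B) = mxsub f g B.
Proof.
by move=> nf; apply/matrixP=> i j; rewrite mul_elem !mxE (negbTE (nf i)).
Qed.

Lemma minor_elem_in n p k (a b : 'I_n) t (B : 'M[R]_(n, p))
    (f : 'I_k -> 'I_n) (g : 'I_k -> 'I_p) s : injective f -> f s = a ->
  \det (mxsub f g (elem a b t *m B))
  = \det (mxsub f g B) + t * \det (mxsub (replace_at f s b) g B).
Proof.
move=> injf fs; set N := mxsub f g B.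
have -> : mxsub f g (elem a b t *m B)
        = setrow N s (row s N + t *: row b (colsub g B)).
  apply/matrixP=> i j; rewrite mul_elem !mxE -fs (inj_eq injf).
  by case: eqP.
rewrite mxsub_replace_at !det_setrow mulmxDl -scalemxAl mxE [in X in _ + X]mxE.
congr (_ + _); rewrite -row_mul mul_mx_adj.
by rewrite !mxE eqxx.
Qed.

Lemma det_replace_at_eq0 n p k (B : 'M[R]_(n, p)) (f : 'I_k -> 'I_n)
    (g : 'I_k -> 'I_p) s j b : f j = b -> j != s ->
  \det (mxsub (replace_at f s b) g B) = 0.
Proof.
move=> fj ne_js; apply: (determinant_alternate ne_js) => l.
by rewrite !mxE /replace_at (negbTE ne_js) eqxx fj.
Qed.

Definition adjacent (n : nat) (a b : 'I_n) : bool :=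
  (a == b.+1 :> nat) || (b == a.+1 :> nat).

Lemma inc_replace_at k n (f : 'I_k -> 'I_n) s b : inc f -> adjacent (f s) b ->
  (forall j, f j <> b) -> inc (replace_at f s b).
Proof.
move=> incf adj nb x y lt_xy; have lt_f := incf _ _ lt_xy; rewrite /replace_at.
have ne z : f z <> b :> nat by move/val_inj; apply: nb.
case: eqP lt_f => [-> | _]; case: eqP => [-> | _] // lt_f.
- by rewrite ltnn in lt_f.
- by have := ne y; case/orP: adj; lia.
- by have := ne x; case/orP: adj; lia.
Qed.

Lemma elemK n (a b : 'I_n) t p (B : 'M[R]_(n, p)) : a != b ->
  elem a b t *m (elem a b (- t) *m B) = B.
Proof.
move=> ne_ab; apply/matrixP=> i j; rewrite !mul_elem !mxE !eqxx.
by case: eqP => [->|//]; rewrite eq_sym (negbTE ne_ab) mulNr subrK.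
Qed.

(** A minor of the new matrix is a difference of two minors of [A], one of
    which has row [b] in place of row [a]; [whitney_ratio] compares them. *)
Lemma whitney_elimination n (A : 'M[R]_n) (b a : 'I_n) (c : 'I_n) :
  TN A -> a = b.+1 :> nat -> 0 < A b c ->
  (forall r : 'I_n, (a < r)%N -> A r c = 0) ->
  (forall r l : 'I_n, (b <= r)%N -> (l < c)%N -> A r l = 0) ->
  TN (elem a b (- (A a c / A b c)) *m A).
Proof.
move=> tnA def_a x_gt0 zc zl k f g incf incg.
have [/existsP[s /eqP fs]|] := boolP [exists s, f s == a]; last first.
  rewrite negb_exists => /forallP nf.
  by rewrite minor_elem_notin //; apply: tnA.
rewrite (minor_elem_in _ _ _ _ (inc_injective incf) fs) mulNr.
have ne_ab : a <> b by move=> eq_ab; move: def_a; rewrite eq_ab; lia.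
have [/existsP[j /eqP fj]|] := boolP [exists j, f j == b].
  rewrite (det_replace_at_eq0 _ _ fj) ?mulr0 ?subr0; first exact: tnA.
  by apply/eqP => eq_js; apply: ne_ab; rewrite -fs -fj eq_js.
rewrite negb_exists => /forallP nf.
pose f' := replace_at f s b.
have incf' : inc f'.
  by apply: inc_replace_at => // [|j]; [rewrite fs /adjacent def_a eqxx|apply/eqP].
have -> : mxsub f g A = mxsub (replace_at f' s a) g A.
  apply: eq_mxsub => // j; rewrite /f' /replace_at; case: eqP => [->|_] //.
rewrite subr_ge0 mulrAC ler_pdivrMr // mulrC [X in _ <= X]mulrC.
apply: (whitney_ratio tnA def_a zc zl) => //; first by rewrite /f' /replace_at eqxx.
move=> j; rewrite /f' /replace_at; case: eqP => [_|ne_js]; first by move/esym.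
by move=> fj; apply: ne_js; apply: (inc_injective incf); rewrite fj fs.
Qed.

Lemma row_nonzero n (A : 'M[R]_n) i : \det A != 0 -> exists j, A i j != 0.
Proof.
move=> d_neq0; have [/existsP//|] := boolP [exists j, A i j != 0].
rewrite negb_exists => /forallP z; case/eqP: d_neq0.
rewrite (expand_det_row _ i) big1 // => j _.
by rewrite (eqP (negbNE (z j))) mul0r.
Qed.

(** The entry to eliminate is the lowest one in the first column that has a
    nonzero entry below the diagonal. The entry above it is positive, since
    otherwise total nonnegativity would make its whole row vanish. The entries
    only decrease, hence the support shrinks. *)
Lemma elimination_step n (A : 'M[R]_n) (r0 c0 : 'I_n) :
  TN A -> \det A != 0 -> (c0 < r0)%N -> A r0 c0 != 0 ->
  exists (a b : 'I_n) (t : R) (B : 'M[R]_n),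
  [/\ adjacent a b, 0 < t, A = elem a b t *m B, TN B &
    ([set p | B p.1 p.2 != 0] \proper [set p | A p.1 p.2 != 0])].
Proof.
move=> tnA d_neq0 lt_cr nz0.
pose P (c : 'I_n) := [exists r : 'I_n, (c < r)%N && (A r c != 0)].
have Pc0 : P c0 by apply/existsP; exists r0; rewrite lt_cr.
case: (arg_minnP (fun c : 'I_n => c : nat) Pc0) => c Pc minc.
have /existsP[r1 r1P] := Pc.
pose Q (r : 'I_n) := (c < r)%N && (A r c != 0).
have /(arg_maxnP (fun r : 'I_n => r : nat)) : Q r1 by [].
case=> a /andP[lt_ca nz_ac] maxa.
have zc (r : 'I_n) : (a < r)%N -> A r c = 0.
  move=> lt_ar; apply/eqP; apply: contraTT lt_ar => nz; rewrite -leqNgt.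
  by case: (leqP r c) => [le_rc|lt_cr']; [lia | apply: (maxa r); rewrite /Q lt_cr'].
have bP : (a.-1 < n)%N by apply: leq_ltn_trans (leq_pred a) (ltn_ord a).
pose b := Ordinal bP; have def_a : a = b.+1 :> nat by rewrite /= prednK //; lia.
have zl (r l : 'I_n) : (b <= r)%N -> (l < c)%N -> A r l = 0.
  move=> le_br lt_lc; apply/eqP; apply: contraTT lt_lc => nz; rewrite -leqNgt.
  case: (ltnP l r) => [lt_lr|]; last by lia.
  by apply: minc; apply/existsP; exists r; rewrite lt_lr.
have ge0 i j : 0 <= A i j by apply: TN_ge0.
have a_gt0 : 0 < A a c by rewrite lt_def nz_ac ge0.
have ne_ab : a != b by apply/eqP => eq_ab; move: def_a; rewrite {1}eq_ab; lia.
have b_gt0 : 0 < A b c.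
  rewrite lt_def ge0 andbT; apply/eqP => z_bc.
  have [j nz_bj] := row_nonzero b d_neq0.
  have lt_cj : (c < j)%N.
    case: (ltngtP c j) => // [lt_jc|/val_inj eq_cj].
      by rewrite zl ?eqxx in nz_bj.
    by rewrite -eq_cj z_bc eqxx in nz_bj.
  have bj_gt0 : 0 < A b j by rewrite lt_def nz_bj ge0.
  have ord2 (x : 'I_2) : x = 0 \/ x = 1.
    by case: x => -[|[|//]] ?; [left | right]; apply: val_inj.
  pose f (x : 'I_2) := if x == 0 then b else a.
  pose g (x : 'I_2) := if x == 0 then c else j.
  have incf : inc f by move=> x y; case: (ord2 x) (ord2 y) => -> [] ->; rewrite //= def_a.
  have incg : inc g by move=> x y; case: (ord2 x) (ord2 y) => -> [] ->.
  have := tnA _ _ _ incf incg.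
  rewrite (expand_det_row _ 0) !big_ord_recl big_ord0 addr0 /cofactor !det_mx11.
  rewrite !mxE /f /g /= z_bc mul0r add0r expr1 mulN1r mulrN.
  by rewrite oppr_ge0 leNgt mulr_gt0.
pose t := A a c / A b c.
have tnB := whitney_elimination tnA def_a b_gt0 zc zl.
exists a, b, t, (elem a b (- t) *m A); split => //.
- by rewrite /adjacent def_a eqxx.
- exact: divr_gt0.
- by rewrite elemK.
have B_a j : (elem a b (- t) *m A) a j = A a j - t * A b j.
  by rewrite mul_elem !mxE eqxx mulNr.
have B_ne i j : i != a -> (elem a b (- t) *m A) i j = A i j.
  by move=> ne; rewrite mul_elem !mxE (negbTE ne).
apply/properP; split.
  apply/subsetP => -[i j]; rewrite !inE /=; have [->|/B_ne->//] := eqVneq i a.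
  apply: contraNneq => z_aj; have := TN_ge0 a j tnB.
  rewrite -/t B_a z_aj sub0r oppr_ge0 oppr_eq0 => le0.
  by rewrite eq_le le0 mulr_ge0 // divr_ge0 // ltW.
exists (a, c); rewrite !inE //= B_a /t divfK ?subrr ?eqxx //.
by rewrite gt_eqF.
Qed.

(** The word records the elementary factors only: diagonal factors change
    neither the sign nor the vanishing of any minor. *)
Inductive move_product (n : nat) : seq ('I_n * 'I_n) -> 'M[R]_n -> Prop :=
| MoveProduct1 : move_product [::] 1%:M
| MoveProductDiag (d : 'rV[R]_n) w B : (forall i, 0 < d 0 i) -> move_product w B ->
    move_product w (diag_mx d *m B)
| MoveProductElem a b t w B : adjacent a b -> 0 < t -> move_product w B ->
    move_product ((a, b) :: w) (elem a b t *m B).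

Lemma move_product_mul n w w' (A B : 'M[R]_n) :
  move_product w A -> move_product w' B -> move_product (w ++ w') (A *m B).
Proof.
move=> pA pB; elim: pA => {w A} [|d w A d_gt0 _ IH|a b t w A adj t_gt0 _ IH].
- by rewrite mul1mx.
- by rewrite -mulmxA; apply: MoveProductDiag.
- by rewrite -mulmxA; apply: MoveProductElem.
Qed.

Lemma move_product_exp n w (A : 'M[R]_n) m :
  move_product w A -> move_product (flatten (nseq m w)) (A ^+ m).
Proof.
move=> pA; elim: m => [|m IH]; first by rewrite expr0; apply: MoveProduct1.
by rewrite exprS /=; apply: move_product_mul.
Qed.

Lemma move_product_tr n w (A : 'M[R]_n) :
  move_product w A -> exists w', move_product w' A^T.
Proof.
elim=> {w A} [|d w A d_gt0 _ [w' IH]|a b t w A adj t_gt0 _ [w' IH]].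
- by exists [::]; rewrite trmx1; apply: MoveProduct1.
- exists (w' ++ [::]); rewrite trmx_mul tr_diag_mx; apply: move_product_mul => //.
  by rewrite -[diag_mx d]mulmx1; apply: MoveProductDiag; last exact: MoveProduct1.
- exists (w' ++ [:: (b, a)]); rewrite trmx_mul; apply: move_product_mul => //.
  rewrite linearD linearZ /= trmx1 trmx_delta -/(elem b a t) -[elem b a t]mulmx1.
  by apply: MoveProductElem; [by rewrite /adjacent orbC | | exact: MoveProduct1].
Qed.

(** Entries below the diagonal are eliminated by row operations, those above
    it by row operations on the transpose. The number of nonzero entries
    decreases, so a diagonal matrix is reached. *)
Theorem TN_factorization n (A : 'M[R]_n) :
  TN A -> \det A != 0 -> exists w, move_product w A.
Proof.
pose nnz (B : 'M[R]_n) := #|[set p | B p.1 p.2 != 0]|.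
have [N] := ubnP (nnz A); elim: N A => // N IH A ltN tnA d_neq0.
have step (B : 'M[R]_n) (r c : 'I_n) : (nnz B < N.+1)%N -> TN B -> \det B != 0 ->
    (c < r)%N -> B r c != 0 -> exists w, move_product w B.
  move=> ltB tnB dB lt_cr nz.
  have [a [b [t [C [adj t_gt0 defB tnC /proper_card ltC]]]]] :=
    elimination_step tnB dB lt_cr nz.
  have [|//||w pC] := IH C; first exact: leq_trans ltC _.
    by move: dB; rewrite defB det_mulmx mulf_eq0 negb_or => /andP[].
  by exists ((a, b) :: w); rewrite defB; apply: MoveProductElem.
have [/existsP[r /existsP[c /andP[lt_cr nz]]]|noL] :=
  boolP [exists r : 'I_n, exists c : 'I_n, (c < r)%N && (A r c != 0)].
  exact: (step A r c).
have [/existsP[r /existsP[c /andP[lt_cr nz]]]|noU] :=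
  boolP [exists r : 'I_n, exists c : 'I_n, (r < c)%N && (A r c != 0)].
  have [||||w pT] := step A^T c r _ _ _ lt_cr.
  - suff -> : nnz A^T = nnz A by [].
    have swapI : injective (fun p : 'I_n * 'I_n => (p.2, p.1)).
      by move=> [i j] [i' j'] [-> ->].
    rewrite /nnz -(card_preimset _ swapI); apply: eq_card => p.
    by rewrite !inE mxE.
  - exact: TN_tr.
  - by rewrite det_tr.
  - by rewrite mxE.
  - by have [w' pA] := move_product_tr pT; rewrite trmxK in pA; exists w'.
have A_diag i j : i != j -> A i j = 0.
  move=> ne_ij; apply/eqP; case: (ltngtP i j) => [lt|lt|/val_inj eq_ij].
  - by apply: contraR noU => nz; apply/existsP; exists i;
       apply/existsP; exists j; rewrite lt.
  - by apply: contraR noL => nz; apply/existsP; exists i;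
       apply/existsP; exists j; rewrite lt.
  - by rewrite eq_ij eqxx in ne_ij.
have def_A : A = diag_mx (\row_i A i i).
  apply/matrixP => i j; rewrite !mxE; case: eqVneq => [->|/A_diag->] //.
exists [::]; rewrite def_A -[diag_mx _]mulmx1; apply: MoveProductDiag.
  move=> i; rewrite mxE lt_def TN_ge0 // andbT.
  have [j] := row_nonzero i d_neq0; case: (eqVneq i j) => [<-//|/A_diag->].
  by rewrite eqxx.
exact: MoveProduct1.
Qed.

End TotalNonnegativity.

(** * Minors as reachability of particle configurations *)

Lemma increasingP k n (f : {ffun 'I_k -> 'I_n}) : reflect (inc f) (increasing f).
Proof.
apply: (iffP forallP) => [incf i j | incf i].
  by move/forallP/(_ j)/implyP: (incf i); apply.
by apply/forallP => j; apply/implyP; apply: incf.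
Qed.

(** A move is an opportunity, not an obligation: all particles may stay. *)
Definition step (k n : nat) (ab : 'I_n * 'I_n) (f f' : {ffun 'I_k -> 'I_n}) :=
  increasing f' /\
  forall i, f' i = f i \/ (f i = ab.1 /\ f' i = ab.2).

Fixpoint reach (k n : nat) (w : seq ('I_n * 'I_n)) (f g : {ffun 'I_k -> 'I_n}) :=
  if w is ab :: w' then exists2 f', step ab f f' & reach w' f' g else f = g.

(** At the first index where the two maps differ, the smaller of both values
    is skipped by the other map. *)
Lemma increasing_separate k n (f g : {ffun 'I_k -> 'I_n}) :
  increasing f -> increasing g -> f != g ->
  exists i, (forall j, f i != g j) \/ (forall j, g i != f j).
Proof.
move=> /increasingP incf /increasingP incg ne_fg.
have [i0 ne0] : exists i, f i != g i.
  apply/existsP; apply: contraNT ne_fg; rewrite negb_exists => /forallP eqfg.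
  by apply/eqP/ffunP => i; apply/eqP/negbNE/eqfg.
have [i ne_i mini] := @arg_minnP _ i0 (fun i => f i != g i) (fun i => i : nat) ne0.
have eq_lt (j : 'I_k) : (j < i)%N -> f j = g j.
  move=> lt_ji; apply/eqP; apply: contraTT lt_ji => /mini; by rewrite -leqNgt.
have sep (f1 g1 : {ffun 'I_k -> 'I_n}) : inc f1 -> inc g1 ->
    (f1 i < g1 i)%N -> (forall j : 'I_k, (j < i)%N -> f1 j = g1 j) ->
    forall j, f1 i != g1 j.
  move=> inc1 inc2 lt_i eq1 j; apply/eqP => /(congr1 val) /= eq_ij.
  case: (ltngtP j i) => [lt_ji|lt_ij|/val_inj eqij].
  - by have := inc1 _ _ lt_ji; rewrite eq1 //; lia.
  - by have := inc2 _ _ lt_ij; lia.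
  - by move: lt_i; rewrite -eqij in eq_ij *; lia.
exists i; case: (ltngtP (f i) (g i)) => [lt|lt|/val_inj eq_i].
- by left; apply: sep.
- by right; apply: sep => // j /eq_lt.
- by rewrite eq_i eqxx in ne_i.
Qed.

Section Reachability.
Variable R : realFieldType.

Lemma minor_1mx k n (f g : {ffun 'I_k -> 'I_n}) :
  increasing f -> increasing g ->
  \det (mxsub f g (1%:M : 'M[R]_n)) = (f == g)%:R.
Proof.
move=> incf incg; have [<-|ne_fg] := eqVneq f g.
  rewrite (_ : mxsub f f 1%:M = 1%:M) ?det1 //; apply/matrixP => i j.
  by rewrite !mxE (inj_eq (inc_injective (increasingP _ incf))).
have [i [ne|ne]] := increasing_separate incf incg ne_fg.
  rewrite (expand_det_row _ i) big1 // => j _.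
  by rewrite !mxE (negbTE (ne j)) mul0r.
rewrite (expand_det_col _ i) big1 // => j _.
by rewrite !mxE eq_sym (negbTE (ne j)) mul0r.
Qed.

(** By multilinearity in row [a], the minor is that of [B], plus [t] times the
    one with [b] in place of [a]; the latter has a repeated row when [b] is
    already present, which is the rule that particles exclude each other. *)
Lemma elem_minor_step k n (a b : 'I_n) (t : R) (B : 'M[R]_n)
    (f g : {ffun 'I_k -> 'I_n}) :
  TN B -> adjacent a b -> 0 < t -> increasing f -> increasing g ->
  0 <= \det (mxsub f g (elem a b t *m B)) /\
  (0 < \det (mxsub f g (elem a b t *m B)) <->
   exists2 f' : {ffun 'I_k -> 'I_n}, step (a, b) f f' & 0 < \det (mxsub f' g B)).
Proof.
move=> tnB adj t_gt0 incf0 incg0.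
have /increasingP incf := incf0; have /increasingP incg := incg0.
have stepff : step (a, b) f f by split=> // i; left.
have f_ge0 := tnB _ _ _ incf incg.
have [/existsP[s /eqP fs]|] := boolP [exists s, f s == a]; last first.
  rewrite negb_exists => /forallP nf; rewrite minor_elem_notin //.
  split=> //; split=> [f_gt0|[f' [_ f'P]]]; first by exists f.
  have -> // : f' = f; apply/ffunP => i; case: (f'P i) => // -[fi _].
  by case/eqP: (nf i).
rewrite (minor_elem_in _ _ _ _ (inc_injective incf) fs).
have [/existsP[j /eqP fj]|] := boolP [exists j, f j == b].
  have ne_js : j != s.
    apply/eqP => eq_js; rewrite eq_js fs in fj.
    by case/orP: adj => /=; rewrite fj; lia.
  rewrite (det_replace_at_eq0 _ _ fj) // mulr0 addr0.
  split=> //; split=> [f_gt0|[f' [/increasingP incf' f'P]]]; first by exists f.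
  have ne_ba : b <> a by move=> e; case/orP: adj; rewrite e; lia.
  have f'j : f' j = b by case: (f'P j) => [->|[e]] //; case: ne_ba; rewrite -fj.
  have -> // : f' = f; apply/ffunP => i; case: (f'P i) => // -[fi f'i].
  have eq_is : i = s by apply: (inc_injective incf); rewrite fi fs.
  by case/eqP: ne_js; rewrite -eq_is; apply: (inc_injective incf'); rewrite f'i.
rewrite negb_exists => /forallP nf.
have incr : inc (replace_at f s b).
  by apply: inc_replace_at; rewrite ?fs // => j; apply/eqP.
have r_ge0 := tnB _ _ _ incr incg.
have t_ge0 := ltW t_gt0.
pose r := finfun (replace_at f s b).
have rE : mxsub r g B = mxsub (replace_at f s b) g B by apply: mxsub_ffunl.
split; first by rewrite addr_ge0 // mulr_ge0.
split=> [gt0|[f' [/increasingP incf' f'P] f'_gt0]].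
  have [f_gt0|f_le0] := ltP 0 (\det (mxsub f g B)); first by exists f.
  exists r; last first.
    rewrite rE; move: gt0; rewrite (le_anti (y := 0) (x := \det (mxsub f g B))) ?f_le0 //.
    by rewrite add0r pmulr_rgt0.
  split; first by apply/increasingP => x y /incr; rewrite !ffunE.
  move=> i; rewrite ffunE /replace_at; case: eqP => [->|_]; by [right | left].
have [f's|ne_f's] := eqVneq (f' s) (f s); last first.
  have -> : mxsub (replace_at f s b) g B = mxsub f' g B.
    apply: eq_mxsub => // i; rewrite /replace_at; case: eqP => [->|ne_is].
      by case: (f'P s) => [e|[_ ->]] //; rewrite e eqxx in ne_f's.
    case: (f'P i) => // -[fi _]; case: ne_is; apply: (inc_injective incf).
    by rewrite fi fs.
  by rewrite ltr_wpDl // mulr_gt0.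
have eq_f : f' = f.
  apply/ffunP => i; case: (f'P i) => // -[fi f'i].
  have eq_is : i = s by apply: (inc_injective incf); rewrite fi fs.
  by rewrite eq_is f's.
by rewrite eq_f in f'_gt0; rewrite ltr_wpDr // mulr_ge0.
Qed.

Lemma diag_minor n k (d : 'rV[R]_n) (B : 'M[R]_n) (f : 'I_k -> 'I_n)
    (g : 'I_k -> 'I_n) :
  \det (mxsub f g (diag_mx d *m B)) = (\prod_i d 0 (f i)) * \det (mxsub f g B).
Proof.
have -> : mxsub f g (diag_mx d *m B) = diag_mx (\row_i d 0 (f i)) *m mxsub f g B.
  by rewrite !mul_diag_mx; apply/matrixP => i j; rewrite !mxE.
by rewrite det_mulmx det_diag; congr (_ * _); apply: eq_bigr => i _; rewrite mxE.
Qed.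

Lemma TN_ffun n (A : 'M[R]_n) :
  (forall k (f g : {ffun 'I_k -> 'I_n}), increasing f -> increasing g ->
     0 <= \det (mxsub f g A)) <-> TN A.
Proof.
split=> [tnA k f g incf incg|tnA k f g /increasingP incf /increasingP incg].
  by rewrite -mxsub_ffun; apply: tnA; apply/increasingP => x y /=; rewrite !ffunE;
    [apply: incf | apply: incg].
exact: tnA.
Qed.

Theorem minor_gt0_reach n w (A : 'M[R]_n) : move_product w A ->
  TN A /\ forall k (f g : {ffun 'I_k -> 'I_n}), increasing f -> increasing g ->
    (0 < \det (mxsub f g A) <-> reach w f g).
Proof.
elim=> {w A} [|d w B d_gt0 _ [tnB IH]|a b t w B adj t_gt0 _ [tnB IH]].
- split; first by apply/TN_ffun => k f g incf incg; rewrite minor_1mx // ler0n.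
  by move=> k f g incf incg; rewrite minor_1mx // ltr0n lt0b; split=> /eqP.
- have prod_gt0 k (f : 'I_k -> 'I_n) : 0 < \prod_i d 0 (f i) by apply: prodr_gt0.
  split=> [|k f g incf incg].
    by move=> k f g incf incg; rewrite diag_minor mulr_ge0 ?tnB // ltW.
  by rewrite diag_minor pmulr_rgt0 //; apply: IH.
split=> [|k f g incf incg].
  by apply/TN_ffun => k f g incf incg; have [] := elem_minor_step tnB adj t_gt0 incf incg.
have [_ ->] := elem_minor_step tnB adj t_gt0 incf incg.
split=> -[f' st]; exists f' => //; have [incf' _] := st.
  by apply/(IH _ _ _ incf' incg).
by apply/(IH _ _ _ incf' incg).
Qed.
End Reachability.

(** * The lattice property and extreme configurations *)

Lemma move_product_adjacent (R : realFieldType) n w (A : 'M[R]_n) :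
  move_product w A -> {in w, forall ab, adjacent ab.1 ab.2}.
Proof.
elim=> {w A} // a b t w A adj _ _ IH ab; rewrite inE => /predU1P[->//|].
exact: IH.
Qed.

Definition fmax k n (f g : {ffun 'I_k -> 'I_n}) : {ffun 'I_k -> 'I_n} :=
  [ffun i => if (f i <= g i)%N then g i else f i].
Definition fmin k n (f g : {ffun 'I_k -> 'I_n}) : {ffun 'I_k -> 'I_n} :=
  [ffun i => if (f i <= g i)%N then f i else g i].

Lemma fmaxE k n (f g : {ffun 'I_k -> 'I_n}) i : fmax f g i = maxn (f i) (g i) :> nat.
Proof. by rewrite ffunE; case: leqP. Qed.

Lemma fminE k n (f g : {ffun 'I_k -> 'I_n}) i : fmin f g i = minn (f i) (g i) :> nat.
Proof. by rewrite ffunE; case: leqP. Qed.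

Lemma stepP k n (a b : 'I_n) (f f' : {ffun 'I_k -> 'I_n}) :
  step (a, b) f f' <->
  increasing f' /\ forall i, f' i = f i :> nat \/ (f i = a :> nat /\ f' i = b :> nat).
Proof.
split=> -[incf' f'P]; split=> // i.
  by case: (f'P i) => [->|[-> ->]]; [left | right].
by case: (f'P i) => [/val_inj|[/val_inj-> /val_inj->]]; [left | right].
Qed.

(** Moves are between neighbours, so the trajectory of the rank-[i] particle
    can switch between two given ones whenever they meet, without jumping over
    either; maxima and minima of positions of the same rank stay distinct. *)
Lemma reach_lattice k n w (f f' g g' : {ffun 'I_k -> 'I_n}) :
  {in w, forall ab, adjacent ab.1 ab.2} ->
  reach w f g -> reach w f' g' ->
  reach w (fmax f f') (fmax g g') /\ reach w (fmin f f') (fmin g g').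
Proof.
elim: w f f' => [|[a b] w IH] f f' adj /=; first by move=> -> ->.
move=> [h /stepP[/increasingP inch hP] rh] [h' /stepP[/increasingP inch' h'P] rh'].
have [|rmax rmin] := IH _ _ _ rh rh'.
  by move=> ab abw; apply: adj; rewrite inE abw orbT.
have /= /orP adj_ab := adj (a, b) (mem_head _ _).
split; [exists (fmax h h') | exists (fmin h h')] => //; apply/stepP; split.
- apply/increasingP => x y lt_xy; rewrite !fmaxE.
  by have := inch _ _ lt_xy; have := inch' _ _ lt_xy; lia.
- by move=> i; rewrite !fmaxE; case: adj_ab => /eqP; case: (hP i) => [->|[-> ->]];
    case: (h'P i) => [->|[-> ->]]; lia.
- apply/increasingP => x y lt_xy; rewrite !fminE.
  by have := inch _ _ lt_xy; have := inch' _ _ lt_xy; lia.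
- by move=> i; rewrite !fminE; case: adj_ab => /eqP; case: (hP i) => [->|[-> ->]];
    case: (h'P i) => [->|[-> ->]]; lia.
Qed.

Lemma reach_refl k n w (f : {ffun 'I_k -> 'I_n}) : increasing f -> reach w f f.
Proof. by move=> incf; elim: w => //= ab w IH; exists f => //; split=> // i; left. Qed.

Lemma inc_ge k n (f : 'I_k -> 'I_n) (i : 'I_k) : inc f -> (i <= f i)%N.
Proof.
move=> incf; case: i => m; elim: m => // m IH lt_m.
have lt_m' := ltnW lt_m.
have := incf (Ordinal lt_m') (Ordinal lt_m) (ltnSn m).
by apply: leq_ltn_trans; apply: IH.
Qed.

Lemma inc_le k n (f : 'I_k -> 'I_n) (i : 'I_k) : inc f -> (f i <= n - k + i)%N.
Proof.
move=> incf; have incr : inc (@rev_ord n \o f \o @rev_ord k).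
  move=> x y lt_xy /=; have := incf (rev_ord y) (rev_ord x).
  by have := ltn_ord y; have := ltn_ord (f (rev_ord x)); rewrite /=; lia.
have := inc_ge (rev_ord i) incr; rewrite /= rev_ordK.
by have := ltn_ord i; have := ltn_ord (f i); lia.
Qed.

Section Corners.
Variables (k n : nat) (le_kn : (k <= n)%N).

Definition lowest : {ffun 'I_k -> 'I_n} := finfun (widen_ord le_kn).

Lemma highest_proof (i : 'I_k) : (n - k + i < n)%N.
Proof. by have := ltn_ord i; lia. Qed.

Definition highest : {ffun 'I_k -> 'I_n} := [ffun i => Ordinal (highest_proof i)].

Lemma increasing_lowest : increasing lowest.
Proof. by apply/increasingP => i j; rewrite !ffunE. Qed.

Lemma increasing_highest : increasing highest.
Proof. by apply/increasingP => i j; rewrite !ffunE /= ltn_add2l. Qed.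

(** The maximum of the journey up and of the constant journey at [f] goes from
    [f] to the top, that of the journey down and of the constant journey at
    [g] from the top to [g]; the minimum of both goes from [f] to [g]. *)
Lemma corner_reach w (f g : {ffun 'I_k -> 'I_n}) :
  {in w, forall ab, adjacent ab.1 ab.2} ->
  reach w lowest highest -> reach w highest lowest ->
  increasing f -> increasing g -> reach w f g.
Proof.
move=> adj up dn incf incg.
have [rf _] := reach_lattice adj up (reach_refl w incf).
have [rg _] := reach_lattice adj dn (reach_refl w incg).
have [_] := reach_lattice adj rf rg.
have eqE (h h' : {ffun 'I_k -> 'I_n}) : (forall i, h i = h' i :> nat) -> h = h'.
  by move=> eq_h; apply/ffunP => i; apply: val_inj; apply: eq_h.
congr reach; apply: eqE => i; rewrite !(fminE, fmaxE) !ffunE /=.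
  have := inc_ge i (increasingP _ incf); have := inc_le i (increasingP _ incf).
  by lia.
have := inc_ge i (increasingP _ incg); have := inc_le i (increasingP _ incg).
by have := inc_le i (increasingP _ incf); lia.
Qed.
End Corners.

(** * Greedy rounds with one more particle *)

(** The effect on heights of a greedy move from [p.-1] to [p]: the least value
    at [p] that still fits its neighbours, since heights increase by [0] or
    [1] at each site. *)
Definition greedy (p : nat) (h : nat -> nat) (q : nat) : nat :=
  if q == p then maxn (h p.-1) (h p.+1).-1 else h q.

Definition run (u : seq nat) (h : nat -> nat) : nat -> nat :=
  foldl (fun h p => greedy p h) h u.

Lemma run_cat u v h : run (u ++ v) h = run v (run u h).
Proof. exact: foldl_cat. Qed.

(** The same greedy move for a single particle that nothing obstructs. *)
Definition hop (w p : nat) : nat := if w == p.-1 then p else w.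
Definition hops (u : seq nat) (w : nat) : nat := foldl hop w u.

Lemma hops_cat u v w : hops (u ++ v) w = hops v (hops u w).
Proof. exact: foldl_cat. Qed.

Lemma hops_ge u w : {in u, forall p, 0 < p}%N -> (w <= hops u w)%N.
Proof.
elim: u w => //= p u IH w pos; have p_gt0 := pos p (mem_head _ _).
apply: (leq_trans (n := hop w p)); first by rewrite /hop; case: eqP; lia.
by apply: IH => q qu; apply: pos; rewrite inE qu orbT.
Qed.

Lemma hops_gt u w : {in u, forall p, 0 < p}%N -> w.+1 \in u -> (w < hops u w)%N.
Proof.
move=> pos /splitPr def_u; case: def_u pos => u1 u2 pos; rewrite hops_cat /=.
have pos1 : {in u1, forall p, 0 < p}%N.
  by move=> p pu; apply: pos; rewrite mem_cat pu.
have pos2 : {in u2, forall p, 0 < p}%N.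
  by move=> p pu; apply: pos; rewrite mem_cat inE pu !orbT.
apply: (leq_trans _ (hops_ge _ pos2)).
by have := hops_ge w pos1; rewrite /hop; case: eqP => /=; lia.
Qed.

Section OneMore.
Variables (n k : nat).
Hypotheses (k_gt0 : (0 < k)%N) (lt_kn : (k.+1 < n)%N).

(** Here [h] is the system of [k] particles, [H] the system of [k.+1] particles
    one round later, and [v] the moves made in between. The particle [w]
    starts at or above the top one of [h] and stays so; one round later it
    stands at [hops v w]. The last clause says that the lower [k] particles of
    [H] are not behind those of [h], nor the top one behind [hops v w], except
    that nothing can get beyond the highest configuration, whose heights are
    [q + k.+1 - n]. *)
Definition lag_inv (h : nat -> nat) (w : nat) (H : nat -> nat) (v : seq nat) : Prop :=
  [/\ forall q, (q <= n)%N -> (h q <= k)%N,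
      forall q, (q <= n)%N -> (w < q)%N -> (k <= h q)%N &
      forall q, (q <= n)%N ->
        (H q <= maxn (h q + (hops v w < q)) (q + k.+1 - n))%N].

Definition sites_ok (u : seq nat) : Prop := forall p, (p \in u) = (0 < p < n)%N.

(** The delicate case is a particle of [h] that stands at [p] while the
    unobstructed particle of [H] does too. But then [w] has reached [p] as
    well, and in the round in between every site had its turn, so that
    the particle of [H] must already be beyond [p], unless [p] is the last
    site. *)
Lemma lag_inv_step h w H p v : sites_ok (p :: v) ->
  lag_inv h w H (p :: v) -> lag_inv (greedy p h) (hop w p) (greedy p H) (rcons v p).
Proof.
move=> ok [hk hw Hh].
have pP : (0 < p < n)%N by rewrite -ok mem_head.
have pos : {in rcons v p, forall p, 0 < p}%N.
  by move=> q; rewrite mem_rcons ok => /andP[].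
have hk' q : (q <= n)%N -> (greedy p h q <= k)%N.
  move=> le_q; rewrite /greedy; case: eqP => _; last exact: hk.
  by have := hk p.-1; have := hk p.+1; lia.
have hw' q : (q <= n)%N -> (hop w p < q)%N -> (k <= greedy p h q)%N.
  move=> le_q; rewrite /greedy /hop; have [->|ne_qp] := eqVneq q p.
    case: eqP => [_|ne_w lt_wp]; first by rewrite ltnn.
    by rewrite leq_max hw //; lia.
  by case: eqP => [eq_w lt_pq|_]; apply: hw => //; lia.
split=> // q le_q.
have hopsE : hops (rcons v p) (hop w p) = hop (hops (p :: v) w) p.
  by rewrite -cats1 hops_cat.
have lag : (hop w p < n.-1)%N -> (hop w p < hop (hops (p :: v) w) p)%N.
  move=> lt_w; rewrite -hopsE; apply: hops_gt => //.
  by rewrite mem_rcons ok; lia.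
have ge_lag : (hop w p <= hop (hops (p :: v) w) p)%N by rewrite -hopsE hops_ge.
rewrite hopsE; move: (hops (p :: v) w) Hh lag ge_lag => W Hh lag ge_lag {hopsE}.
rewrite {1}/greedy; have [eq_q|ne_qp] := eqVneq q p; last first.
  have := Hh q le_q; rewrite /greedy (negbTE ne_qp) /hop.
  by case: eqP => [eqW|_]; lia.
rewrite {q}eq_q in le_q *.
have Hl := Hh p.-1 ltac:(lia); have Hr := Hh p.+1 ltac:(lia).
have hwp := hw' p le_q; have hkp := hk p.+1 ltac:(lia).
rewrite /greedy eqxx in hwp *.
have W'E : hop W p = if W == p.-1 then p else W by [].
move: (hop W p) (hop w p) W'E lag ge_lag hwp => W' w' W'E lag ge_lag hwp.
move: (h p.-1) (h p.+1) (H p.-1) (H p.+1) Hl Hr hkp hwp => hl hr Hl Hr.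
move=> le_Hl le_Hr hkp hwp {Hh hk hw hk' hw' pos ok h H}.
have W_W' : (W < p.-1)%N = (W' < p)%N by rewrite W'E; case: eqP; lia.
rewrite W_W' in le_Hl.
have [lt_W'|le_pW'] := ltnP W' p.
  have := leq_b1 (W < p.+1)%N; move: le_Hl le_Hr; rewrite lt_W' /=.
  by move: (_ < _)%N => b; clear; lia.
rewrite ltnNge le_pW' /= in le_Hl.
have [lt_W|le_pW] := ltnP W p.+1; last first.
  by move: le_Hl le_Hr; rewrite ltnNge le_pW /=; clear; lia.
have eW' : W' = p by move: W'E le_pW'; case: eqP; lia.
rewrite lt_W eW' in le_Hr lag ge_lag.
have [lt_w'|le_pw'] := ltnP w' p; first by have := hwp lt_w'; clear -le_Hl le_Hr hkp; lia.
have [lt_p|le_p] := ltnP w' n.-1; first by have := lag lt_p; clear -le_pw'; lia.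
by clear -le_Hl le_Hr hkp ge_lag le_p; lia.
Qed.

(** The window of moves that separates both systems is rotated as they run. *)
Lemma lag_inv_run u v h w H : sites_ok (u ++ v) -> lag_inv h w H (u ++ v) ->
  lag_inv (run u h) (hops u w) (run u H) (v ++ u).
Proof.
elim: u v h w H => [|p u IH] v h w H ok inv; first by rewrite cats0.
rewrite /= -cat_rcons; apply: IH.
  by move=> q; rewrite -rcons_cat mem_rcons ok.
by rewrite -rcons_cat; apply: lag_inv_step.
Qed.

Definition rounds (u : seq nat) (m : nat) := flatten (nseq m u).

(** The hypothesis and the conclusion say that the greedy journey from the
    lowest configuration, of heights [minn k], has reached the highest one.
    In the end [w] must be at the last site, because it is at or above the top
    particle; the invariant is then the conclusion. *)
Lemma rounds_lag u m : sites_ok u ->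
  (forall q, (q <= n)%N -> (run (rounds u m) (minn k) q <= q - (n - k))%N) ->
  forall q, (q <= n)%N ->
    (run (rounds u m.+1) (minn k.+1) q <= q - (n - k.+1))%N.
Proof.
move=> ok done_k.
have pos : {in u, forall p, 0 < p}%N by move=> p; rewrite ok => /andP[].
have inv0 : lag_inv (minn k) k (run u (minn k.+1)) u.
  have [le_q le_w] : (forall q, (run u (minn k.+1) q <= q)%N) /\
      (forall q, (run u (minn k.+1) q <= k + (hops u k < q))%N).
    have gen H w : (forall q, (H q <= q)%N) -> (forall q, (H q <= k + (w < q))%N) ->
        (forall q, (run u H q <= q)%N) /\
        (forall q, (run u H q <= k + (hops u w < q))%N); last by apply: gen => q; lia.
    elim: u {ok done_k} pos H w => // p u IH pos H w Hq Hw /=.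
    have p_gt0 := pos p (mem_head _ _).
    apply: IH; first by move=> q qu; apply: pos; rewrite inE qu orbT.
      move=> q; rewrite /greedy; have [->|_] := eqVneq q p; last exact: Hq.
      by have := Hq p.-1; have := Hq p.+1; lia.
    move=> q; rewrite /greedy; have [->|ne_qp] := eqVneq q p.
      by have := Hw p.-1; have := Hw p.+1; rewrite /hop; case: eqP; lia.
    by have := Hw q; rewrite /hop; case: eqP; lia.
  split=> q le_qn; [lia | lia |].
  by have := le_q q; have := le_w q; lia.
have invm : forall h w H, lag_inv h w H u -> exists w',
    lag_inv (run (rounds u m) h) w' (run (rounds u m) H) u.
  elim: (m) => [|j IH] h w H inv; first by exists w.
  rewrite /rounds /= -/(rounds u j) !run_cat; apply: (IH _ (hops u w)).
  by have := @lag_inv_run u [::] h w H; rewrite cats0; apply.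
have [w [_ hw Hh]] := invm _ _ _ inv0.
have le_w : (n.-1 <= w)%N.
  rewrite leqNgt; apply/negP => lt_w.
  have := hw n.-1 (leq_pred n) lt_w; have := done_k n.-1 (leq_pred n).
  by lia.
move=> q le_q; rewrite /rounds /= -/(rounds u m) run_cat.
have := Hh q le_q; have := done_k q le_q; have := hops_ge w pos.
have [->|ne_q] := eqVneq q n; first by lia.
have [lt_wq|_] := ltnP (hops u w) q; lia.
Qed.
End OneMore.

(** Particles of [h'] are the holes of [h], with the line reversed. *)
Definition mirrored (n k : nat) (h h' : nat -> nat) : Prop :=
  forall q, (q <= n)%N -> (h' q + k = q + h (n - q))%N.

Lemma mirrored_greedy n k p h h' : (0 < p < n)%N ->
  mirrored n k h h' -> mirrored n k (greedy p h) (greedy (n - p) h').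
Proof.
move=> pP mir q le_q; rewrite /greedy.
have -> : (n - q == p)%N = (q == n - p)%N by lia.
case: eqP => [->|_]; last exact: mir.
have := mir (n - p).-1 ltac:(lia); have := mir (n - p).+1 ltac:(lia).
have -> : (n - (n - p).-1 = p.+1)%N by lia.
have -> : (n - (n - p).+1 = p.-1)%N by lia.
lia.
Qed.

Lemma mirrored_run n k u h h' : {in u, forall p, 0 < p < n}%N ->
  mirrored n k h h' ->
  mirrored n k (run u h) (run [seq (n - p)%N | p <- u] h').
Proof.
elim: u h h' => //= p u IH h h' uP mir; apply: IH.
  by move=> q qu; apply: uP; rewrite inE qu orbT.
by apply: mirrored_greedy => //; apply: uP; rewrite mem_head.
Qed.

Lemma mirrored_lowest n k : (k <= n)%N -> mirrored n k (minn k) (minn (n - k)).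
Proof. by move=> le_kn q le_q; lia. Qed.

Lemma rounds_map f u m : rounds [seq f p | p <- u] m = [seq f p | p <- rounds u m].
Proof. by rewrite /rounds map_flatten map_nseq. Qed.

Lemma mem_rounds u m : {subset rounds u m <= u}.
Proof. by move=> p /flattenP[s /nseqP[-> _]]. Qed.

Lemma rounds_lag_dual n k u m : (0 < k)%N -> (k.+1 < n)%N -> sites_ok n u ->
  (forall q, (q <= n)%N -> (run (rounds u m) (minn k.+1) q <= q - (n - k.+1))%N) ->
  forall q, (q <= n)%N -> (run (rounds u m.+1) (minn k) q <= q - (n - k))%N.
Proof.
move=> k_gt0 lt_kn ok done_k1 q le_q.
pose u' := [seq (n - p)%N | p <- u].
have ok' : sites_ok n u'.
  move=> p; apply/mapP/idP => [[x] | pP]; first by rewrite ok; lia.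
  by exists (n - p)%N; rewrite ?ok; lia.
have uP j : {in rounds u j, forall p, 0 < p < n}%N.
  by move=> p /mem_rounds; rewrite ok.
have mir j k' : (k' <= n)%N -> mirrored n k' (run (rounds u j) (minn k'))
    (run (rounds u' j) (minn (n - k'))).
  move=> le_k'; rewrite rounds_map; apply: mirrored_run; first exact: uP.
  exact: mirrored_lowest.
have eq_k : (n - k = (n - k.+1).+1)%N by lia.
have := mir m.+1 k ltac:(lia) (n - q)%N ltac:(lia).
have -> : (n - (n - q) = q)%N by lia.
rewrite eq_k.
have done_mir r : (r <= n)%N ->
    (run (rounds u' m) (minn (n - k.+1)) r <= r - (n - (n - k.+1)))%N.
  move=> le_r; have := mir m k.+1 ltac:(lia) r le_r.
  by have := done_k1 (n - r)%N ltac:(lia); lia.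
have := @rounds_lag n (n - k.+1) ltac:(lia) ltac:(lia) u' m ok' done_mir (n - q)%N.
by lia.
Qed.

(** * Heights of configurations *)

Definition height k n (f : 'I_k -> 'I_n) (q : nat) : nat :=
  (\sum_(i < k) (f i < q))%N.

Definition occupied k n (f : 'I_k -> 'I_n) (q : nat) : bool :=
  [exists i, f i == q :> nat].

Lemma heightS k n (f : 'I_k -> 'I_n) q : inc f ->
  height f q.+1 = (height f q + occupied f q)%N.
Proof.
move=> incf; have -> : (occupied f q : nat) = (\sum_(i < k) (f i == q :> nat))%N.
  have [/existsP[s /eqP fs]|] := boolP (occupied f q).
    rewrite (bigD1 s) //= fs eqxx big1 // => i ne_is.
    case: eqP => // fi; case/eqP: ne_is; apply: (inc_injective incf).
    by apply: val_inj; rewrite /= fi fs.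
  rewrite negb_exists => /forallP nf; rewrite big1 // => i _.
  by rewrite (negbTE (nf i)).
rewrite /height -big_split /=; apply: eq_bigr => i _.
by rewrite ltnS leq_eqVlt; case: ltngtP.
Qed.

Lemma height_widen k n (c : nat) (f : 'I_k -> 'I_n) q :
  (forall i, f i = c + i :> nat)%N -> height f q = minn k (q - c).
Proof.
move=> fE; rewrite /height.
under eq_bigr => i _ do rewrite fE -ltn_subRL.
move: (q - c)%N => m {fE f}; elim: k => [|k IH]; first by rewrite big_ord0; lia.
by rewrite big_ord_recr /= IH; lia.
Qed.

Lemma height_lowest k n (le_kn : (k <= n)%N) q : height (lowest le_kn) q = minn k q.
Proof. by rewrite (@height_widen _ _ 0) ?subn0 // => i; rewrite ffunE. Qed.

Lemma height_highest k n (le_kn : (k <= n)%N) q : (q <= n)%N ->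
  height (highest le_kn) q = (q - (n - k))%N.
Proof.
move=> le_q; rewrite (@height_widen _ _ (n - k)) => [|i]; last by rewrite ffunE.
by lia.
Qed.

(** A particle [i] below its highest position would raise the height there to
    at least [i.+1], above the bound [i]. *)
Lemma height_highest_le k n (le_kn : (k <= n)%N) (g : {ffun 'I_k -> 'I_n}) :
  increasing g -> (forall q, (q <= n)%N -> (height g q <= q - (n - k))%N) ->
  g = highest le_kn.
Proof.
move=> /increasingP incg le_h; apply/ffunP => i; apply: val_inj => /=.
apply/eqP; rewrite ffunE /= eqn_leq inc_le //= leqNgt; apply/negP => lt_g.
have lt_i := ltn_ord i.
have := le_h (n - k + i)%N ltac:(lia); rewrite addKn leqNgt => /negP; apply.
have := height_lowest le_kn i.+1; rewrite (minn_idPr lt_i) => <-.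
apply: leq_sum => j _; rewrite ffunE /= ltnS.
case: (leqP j i) => // le_ji.
suff -> : (g j < n - k + i)%N by [].
case: (ltngtP j i) le_ji => // [lt_ji _|/val_inj-> _] //.
exact: ltn_trans (incg _ _ lt_ji) lt_g.
Qed.

(** The greedy journey up declines every downward move. *)
Definition up_sites n (w : seq ('I_n * 'I_n)) : seq nat :=
  [seq nat_of_ord ab.2 | ab : 'I_n * 'I_n <- w & ab.2 == ab.1.+1 :> nat].

Lemma le_height k n (f f' : 'I_k -> 'I_n) q :
  (forall i, (f' i < q)%N -> (f i < q)%N) -> (height f' q <= height f q)%N.
Proof.
by move=> le_f; apply: leq_sum => i _; case: ltnP => // /le_f ->.
Qed.

Lemma height_mono k n (f : 'I_k -> 'I_n) q q' : (q <= q')%N ->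
  (height f q <= height f q')%N.
Proof.
move=> le_q; apply: leq_sum => i _.
by case: (ltnP (f i) q) => // lt_f; rewrite (leq_trans lt_f).
Qed.

(** No journey gets higher than the greedy one: the greedy rule is monotone,
    and a legal move never brings a height below its greedy value. *)
Lemma run_le_height k n w (f g : {ffun 'I_k -> 'I_n}) h :
  {in w, forall ab, adjacent ab.1 ab.2} -> increasing f -> reach w f g ->
  (forall q, h q <= height f q)%N ->
  forall q, (run (up_sites w) h q <= height g q)%N.
Proof.
elim: w f h => [|[a b] w IH] f h adj incf /= => [<- //|].
case=> f' /stepP[incf' f'P] r le_h.
have adjw : {in w, forall ab, adjacent ab.1 ab.2}.
  by move=> ab abw; apply: adj; rewrite inE abw orbT.
have /= /orP adj_ab := adj (a, b) (mem_head _ _).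
rewrite /up_sites /=; case: (eqVneq (b : nat) a.+1) => [def_b|ne_b] /=.
  apply: (IH f') => // q.
  have ne_le (q' : nat) : q' != b :> nat -> (h q' <= height f' q')%N.
    move=> ne_q; apply: leq_trans (le_h _) _; apply: le_height => i.
    by case: (f'P i) => [->|[-> ->]] //; lia.
  rewrite /greedy; have [->|/ne_le//] := eqVneq q (b : nat).
  have := ne_le b.-1 ltac:(lia); have := ne_le b.+1 ltac:(lia).
  have := heightS b (increasingP _ incf'); have := leq_b1 (occupied f' b).
  by have := @height_mono _ _ f' b.-1 b (leq_pred _); lia.
apply: (IH f') => // q; apply: leq_trans (le_h q) _; apply: le_height => i.
by case: adj_ab => /eqP; case: (f'P i) => [->|[-> ->]] //; lia.
Qed.

(** The greedy strategy can be carried out by actual moves. *)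
Lemma height_le_run k n w (f : {ffun 'I_k -> 'I_n}) h :
  {in w, forall ab, adjacent ab.1 ab.2} -> increasing f ->
  (forall q, height f q <= h q)%N ->
  exists g : {ffun 'I_k -> 'I_n}, [/\ increasing g, reach w f g &
    forall q, (height g q <= run (up_sites w) h q)%N].
Proof.
elim: w f h => [|[a b] w IH] f h adj incf le_h; first by exists f.
have adjw : {in w, forall ab, adjacent ab.1 ab.2}.
  by move=> ab abw; apply: adj; rewrite inE abw orbT.
have /= adj_ab := adj (a, b) (mem_head _ _).
pose h' := if b == a.+1 :> nat then greedy b h else h.
suff [f' [incf' st le_h']] : exists f' : {ffun 'I_k -> 'I_n},
    [/\ increasing f', step (a, b) f f' & forall q, (height f' q <= h' q)%N].
  have [g [incg r le_g]] := IH f' h' adjw incf' le_h'.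
  exists g; split=> //; first by exists f'.
  by move=> q; have := le_g q; rewrite /h' /up_sites /=; case: eqP.
have stay : step (a, b) f f by split=> // i; left.
rewrite /h'; have [def_b|_] := eqVneq (b : nat) a.+1; last by exists f.
have greedy_b : (maxn (h a) (h b.+1).-1 = greedy b h b)%N by rewrite /greedy eqxx def_b.
have greedy_ne (q : nat) : q != b :> nat -> greedy b h q = h q by rewrite /greedy => /negbTE->.
have [occ_b|free_b] := boolP (occupied f b).
  exists f; split=> // q; have [->|/greedy_ne->//] := eqVneq q (b : nat).
  have := heightS b (increasingP _ incf); rewrite occ_b -greedy_b.
  by have := le_h b.+1; lia.
have [/existsP[s /eqP /val_inj fs]|free_a] := boolP (occupied f a); last first.
  exists f; split=> // q; have [->|/greedy_ne->//] := eqVneq q (b : nat).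
  have := heightS a (increasingP _ incf); rewrite (negbTE free_a) -greedy_b -def_b.
  by have := le_h a; lia.
have nb j : f j <> b.
  by move=> fj; case/negP: free_b; apply/existsP; exists j; rewrite fj.
have incr : inc (replace_at f s b).
  by apply: inc_replace_at => //; [apply/increasingP | rewrite fs].
pose r : {ffun 'I_k -> 'I_n} := finfun (replace_at f s b).
have rE i : r i = replace_at f s b i by rewrite ffunE.
have incfr : inc r by move=> x y; rewrite !rE; apply: incr.
exists r; split; first exact/increasingP.
  split=> [|i]; first exact/increasingP.
  by rewrite rE /replace_at; case: eqP => [->|_]; [right | left].
move=> q; have [->|ne_q] := eqVneq q (b : nat).
  have : ~~ occupied r a.
    rewrite negb_exists; apply/forallP => i; rewrite rE /replace_at.
    case: (i =P s) => [_|ne_is]; first by lia.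
    by apply/eqP => /val_inj fi; apply: ne_is;
       apply: (inc_injective (increasingP _ incf)); rewrite fi fs.
  have := heightS a incfr; rewrite -def_b -greedy_b => -> /negbTE ->.
  rewrite addn0; apply: leq_trans (leq_maxl _ _); apply: leq_trans (le_h a).
  apply: le_height => i; rewrite rE /replace_at; case: eqP => // _; lia.
rewrite greedy_ne //; apply: leq_trans (le_h q); apply: le_height => i.
by rewrite rE /replace_at; case: eqP => // -> ; rewrite fs; lia.
Qed.

Lemma reach_corner k n (le_kn : (k <= n)%N) w :
  {in w, forall ab, adjacent ab.1 ab.2} ->
  reach w (lowest le_kn) (highest le_kn) <->
  forall q, (q <= n)%N -> (run (up_sites w) (minn k) q <= q - (n - k))%N.
Proof.
move=> adj; split=> [r q le_q|le_run].
  rewrite -(height_highest le_kn) //; apply: run_le_height r _ _ => //.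
    exact: increasing_lowest.
  by move=> q'; rewrite height_lowest.
have [|g [incg r le_g]] := @height_le_run _ _ w (lowest le_kn) (minn k) adj
  (increasing_lowest _); first by move=> q; rewrite height_lowest.
rewrite -(height_highest_le le_kn incg) // => q le_q.
by apply: leq_trans (le_g q) _; apply: le_run.
Qed.

(** * Exponents *)

Lemma up_sites_cat n (w w' : seq ('I_n * 'I_n)) :
  up_sites (w ++ w') = up_sites w ++ up_sites w'.
Proof. by rewrite /up_sites filter_cat map_cat. Qed.

Lemma up_sites_rounds n (w : seq ('I_n * 'I_n)) m :
  up_sites (flatten (nseq m w)) = rounds (up_sites w) m.
Proof. by elim: m => //= m IH; rewrite up_sites_cat IH. Qed.

Lemma run_notin u h p : p \notin u -> run u h p = h p.
Proof.
elim: u h => //= q u IH h; rewrite inE negb_or => /andP[ne_pq /IH->].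
by rewrite /greedy (negbTE ne_pq).
Qed.

Section Exponents.
Variable R : realFieldType.

Definition corner n k (le_kn : (k <= n)%N) (A : 'M[R]_n) : Prop :=
  0 < \det (mxsub (lowest le_kn) (highest le_kn) A).

Lemma corner_exp n k (le_kn : (k <= n)%N) w (A : 'M[R]_n) m :
  move_product w A -> corner le_kn (A ^+ m) <->
  forall q, (q <= n)%N ->
    (run (rounds (up_sites w) m) (minn k) q <= q - (n - k))%N.
Proof.
move=> pA; have pAm := move_product_exp m pA.
have [_ reachP] := minor_gt0_reach pAm.
rewrite /corner reachP ?increasing_lowest ?increasing_highest //.
by rewrite (reach_corner _ (move_product_adjacent pAm)) up_sites_rounds.
Qed.

(** A site without an upward move is never crossed, so even a single particle
    could not reach the top. *)
Lemma corner1_sites n (le_1n : (1 <= n)%N) w (A : 'M[R]_n) m :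
  move_product w A -> corner le_1n (A ^+ m) -> sites_ok n (up_sites w).
Proof.
move=> pA /(corner_exp le_1n m pA) run_le p; apply/idP/idP.
  case/mapP => -[a b]; rewrite mem_filter /= => /andP[/eqP def_b _] ->.
  by rewrite ltn_ord def_b.
move=> pP; apply: contraT => notin_p; have := run_le p ltac:(lia).
rewrite run_notin; first by lia.
by apply: contra notin_p => /mem_rounds.
Qed.

Lemma corner_lag n k (le_kn : (k <= n)%N) (le_k1n : (k.+1 <= n)%N)
    (le_1n : (1 <= n)%N) (A : 'M[R]_n) w m0 :
  (0 < k)%N -> (k.+1 < n)%N -> move_product w A -> corner le_1n (A ^+ m0) ->
  forall m, (corner le_kn (A ^+ m) -> corner le_k1n (A ^+ m.+1)) /\
            (corner le_k1n (A ^+ m) -> corner le_kn (A ^+ m.+1)).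
Proof.
move=> k_gt0 lt_k1n pA c1 m; have ok := corner1_sites pA c1.
by split; rewrite !(corner_exp _ _ pA); [apply: rounds_lag | apply: rounds_lag_dual].
Qed.

Lemma trmx_exp n (A : 'M[R]_n) m : (A ^+ m)^T = A^T ^+ m.
Proof.
elim: m => [|m IH]; first by rewrite !expr0 trmx1.
by rewrite exprS exprSr -IH trmx_mul.
Qed.

Lemma det_exp n (A : 'M[R]_n) m : \det (A ^+ m) = \det A ^+ m.
Proof.
elim: m => [|m IH]; first by rewrite !expr0 det1.
by rewrite !exprS det_mulmx IH.
Qed.
End Exponents.

Section RealExponents.
Variable R : realType.

Lemma minors_gt0_corners n k (le_kn : (k <= n)%N) (A : 'M[R]_n) w m :
  move_product w A ->
  minors_gt0 k (A ^+ m) <->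
  corner le_kn (A ^+ m) /\ corner le_kn (A^T ^+ m).
Proof.
move=> pA; have pAm := move_product_exp m pA.
have [_ reachP] := minor_gt0_reach pAm.
have incl := increasing_lowest le_kn; have inch := increasing_highest le_kn.
rewrite /corner -trmx_exp -trmx_mxsub det_tr; split=> [|[up dn]].
  move=> /forallP pos; split.
    by have /forallP/(_ (highest le_kn)) := pos (lowest le_kn); rewrite incl inch.
  by have /forallP/(_ (lowest le_kn)) := pos (highest le_kn); rewrite incl inch.
apply/forallP => f; apply/forallP => g; apply/implyP => incf; apply/implyP => incg.
apply/(reachP _ _ _ incf incg).
apply: (corner_reach (le_kn := le_kn)) => //; first exact: move_product_adjacent pAm.
  by apply/(reachP _ _ _ incl inch).
by apply/(reachP _ _ _ inch incl).
Qed.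

Lemma oscillatory_move_product n (A : 'M[R]_n) :
  oscillatory A -> exists w, move_product w A.
Proof.
case=> tnA [m [m_gt0 tpA]]; apply: TN_factorization.
  apply/TN_ffun => k f g incf incg.
  by have /forallP/(_ f)/forallP/(_ g) := tnA k; rewrite incf incg.
have /forallP/(_ (finfun id))/forallP/(_ (finfun id)) := tpA n.
have inc_id : increasing (finfun id : {ffun 'I_n -> 'I_n}).
  by apply/increasingP => i j; rewrite !ffunE.
rewrite inc_id /minor mxsub_ffun mxsub_id det_exp => /= det_gt0.
by apply: contraTneq det_gt0 => ->; rewrite expr0n gtn_eqF // ltxx.
Qed.

Lemma minors_gt0_lag n k (A : 'M[R]_n) m :
  oscillatory A -> (0 < k)%N -> (k.+1 < n)%N ->
  (minors_gt0 k (A ^+ m) -> minors_gt0 k.+1 (A ^+ m.+1)) /\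
  (minors_gt0 k.+1 (A ^+ m) -> minors_gt0 k (A ^+ m.+1)).
Proof.
move=> oscA k_gt0 lt_k1n; have [w pA] := oscillatory_move_product oscA.
have [w' pAT] := move_product_tr pA.
have [_ [m0 [_ /(_ 1%N) pos1]]] := oscA.
have le_1n : (1 <= n)%N by lia.
have le_kn : (k <= n)%N by lia.
have le_k1n := ltnW lt_k1n.
have [c1 c1T] := (minors_gt0_corners le_1n m0 pA).1 pos1.
have [up1 up2] := corner_lag le_kn le_k1n k_gt0 lt_k1n pA c1 m.
have [dn1 dn2] := corner_lag le_kn le_k1n k_gt0 lt_k1n pAT c1T m.
rewrite !(minors_gt0_corners le_kn _ pA) !(minors_gt0_corners le_k1n _ pA).
by split=> -[c cT]; split; [exact: up1 | exact: dn1 | exact: up2 | exact: dn2].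
Qed.

Lemma exponentP n (A : 'M[R]_n) (oscA : oscillatory A) k :
  minors_gt0 k (A ^+ exponent oscA k) /\
  forall m, (0 < m)%N -> minors_gt0 k (A ^+ m) -> (exponent oscA k <= m)%N.
Proof.
rewrite /exponent; case: ex_minnP => m /andP[_ posm] minm; split=> // j j_gt0 posj.
by apply: minm; rewrite j_gt0.
Qed.
End RealExponents.

Theorem theorem5p6 (R : realType) (n : nat) (hn : (2 <= n)%N)
    (A : 'M[R]_n) (oscA : oscillatory A)
    (k : nat) (hk1 : (1 <= k)%N) (hk2 : (k <= n - 2)%N) :
  `|(exponent oscA k.+1)%:Z - (exponent oscA k)%:Z| <= 1.
Proof.
have lt_k1n : (k.+1 < n)%N by lia.
have [posk mink] := exponentP oscA k; have [posk1 mink1] := exponentP oscA k.+1.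
have := mink1 _ (ltn0Sn _) ((minors_gt0_lag _ oscA hk1 lt_k1n).1 posk).
have := mink _ (ltn0Sn _) ((minors_gt0_lag _ oscA hk1 lt_k1n).2 posk1).
by lia.
Qed.
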